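(* Let $\bar z\in\mathbb R^n$ be an implicitly M-stationary point for (P). Then $\bar z$ is explicitly M-stationary provided the mapping from $\mathbb R^n\times\mathbb R^s$ to $\mathbb R^n\times\mathbb R^m$ given by $$(z,w)\rightrightarrows\{(z,\lambda)\mid\lambda\in F(z),\ w\in G(z,\lambda)\}$$ is inner semicompact at $(\bar z,0)$ w.r.t. its domain, while the mapping $$(z,w,q,\lambda)\rightrightarrows\bigl(z-q,\ F(z)-\lambda,\ G(q,\lambda)-w\bigr)$$ from $\mathbb R^n\times\mathbb R^s\times\mathbb R^n\times\mathbb R^m$ to $\mathbb R^n\times\mathbb R^m\times\mathbb R^s$ is metrically subregular at $((\bar z,0,\bar z,\lambda),(0,0,0))$ for each $\lambda\in K(\bar z)$.
   Context: Let $f\colon\mathbb R^n\to\mathbb R$ be locally Lipschitz continuous, let $F\colon\mathbb R^n\rightrightarrows\mathbb R^m$ and $G\colon\mathbb R^n\times\mathbb R^m\rightrightarrows\mathbb R^s$ be set-valued mappings with closed graphs, and let $M\subset\mathbb R^n$ be nonempty and closed. Set $H(z):=\bigcup_{\lambda\in F(z)}G(z,\lambda)$; it is assumed that $\operatorname{gph}H$ is (locally) closed. Problem (P): minimize $f(z)$ over $z\in\mathbb R^n$ subject to $0\in H(z)$, $z\in M$. Put $K(z):=\{\lambda\in F(z)\mid 0\in G(z,\lambda)\}$. Variational analysis: products carry the sum of Euclidean norms; $\operatorname{dist}(z,A)=\inf_{a\in A}\|a-z\|$ ($=+\infty$ if $A=\varnothing$). For a set-valued mapping $\Upsilon$, $\operatorname{dom}\Upsilon=\{z\mid\Upsilon(z)\neq\varnothing\}$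 and $\Upsilon^{-1}(w)=\{z\mid w\in\Upsilon(z)\}$. $\Upsilon$ is metrically subregular at $(\bar z,\bar w)\in\operatorname{gph}\Upsilon$ if there are $\kappa>0$ and a neighborhood $U$ of $\bar z$ with $\operatorname{dist}(z,\Upsilon^{-1}(\bar w))\le\kappa\operatorname{dist}(\bar w,\Upsilon(z))$ for all $z\in U$. $\Upsilon$ is inner semicompact at $\bar z\in\operatorname{dom}\Upsilon$ w.r.t. a set $\Omega$ if for each sequence $\{z_k\}\subset\Omega$ with $z_k\to\bar z$ there are a subsequence $\{z_{k_l}\}$ and a convergent sequence $\{w_l\}$ with $w_l\in\Upsilon(z_{k_l})$ for all $l$. For a closed set $A$ and $\bar z\in A$: $\mathcal T_A(\bar z)$ is the Bouligand tangent cone, $\widehat{\mathcal N}_A(\bar z)$ its polar, and the limiting normal cone $\mathcal N_A(\bar z)$ consists of all limits $\xi=\lim\xi_k$ with $\xi_k\in\widehat{\mathcal N}_A(z_k)$, $z_k\in A$, $z_k\to\bar z$. Limiting subdifferential: $\partial f(\bar z)=\{\xi\mid(\xi,-1)\in\mathcal N_{\operatorname{epi}f}(\bar z,f(\bar z))\}$. Limiting coderivative: $D^*\Upsilon(\bar z,\bar w)(\eta)=\{\xi\mid(\xi,-\eta)\in\mathcal N_{\operatorname{gph}\Upsilon}(\bar z,\bar w)\}$. A feasible point $\bar z$ of (P) is called implicitly M-stationary if there is $\nu\in\mathbb R^s$ with $0\in\partial f(\bar z)+D^*H(\bar z,0)(\nu)+\mathcal N_M(\bar z)$; it is called explicitly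 M-stationary if there are $\bar\lambda\in K(\bar z)$, $\mu\in\mathbb R^m$, $\nu\in\mathbb R^s$ with $0\in\partial f(\bar z)+D^*F(\bar z,\bar\lambda)(\mu)+\{\xi\in\mathbb R^n\mid(\xi,\mu)\in D^*G((\bar z,\bar\lambda),0)(\nu)\}+\mathcal N_M(\bar z)$. *)

(* Defs.v *)
From HB Require Import structures.
From mathcomp Require Import all_boot all_order all_algebra.
From mathcomp Require Import all_classical all_reals all_analysis.
From mathcomp Require Import ring lra.

Set Implicit Arguments.
Unset Strict Implicit.
Unset Printing Implicit Defensive.

Import Order.TTheory GRing.Theory Num.Theory.
Import numFieldNormedType.Exports.
Local Open Scope classical_set_scope.
Local Open Scope ring_scope.

(* MathComp-Analysis puts the max norm on row vectors and on products.  The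
   structure below adds, on top of the (equivalent) topology of that norm, the
   two metric data of variational analysis: the inner product [dot], used for
   polars, and the norm [enorm], used for distances.  On products the inner
   product is the sum of the inner products, whereas [enorm] is the sum of the
   norms; hence [enorm] is in general not [Num.sqrt (dot x x)]. *)
HB.mixin Record NormedModule_isEuclid (R : realType) V of NormedModule R V := {
  dot : V -> V -> R ;
  dotC : forall x y, dot x y = dot y x ;
  dotDl : forall x y z, dot (x + y) z = dot x z + dot y z ;
  dotZl : forall a x y, dot (a *: x) y = a * dot x y ;
  dot_gt0 : forall x, x != 0 -> 0 < dot x x ;
  enorm : V -> R ;
  ler_enormD : forall x y, enorm (x + y) <= enorm x + enorm y ;
  enormZ : forall a x, enorm (a *: x) = `|a| * enorm x ;
  enorm_equiv : exists2 c : R, 0 < c &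
    forall x, `|x| <= c * enorm x /\ enorm x <= c * `|x|
}.

#[short(type="euclidType")]
HB.structure Definition Euclid (R : realType) :=
  {V of NormedModule R V & NormedModule_isEuclid R V}.

Section real_euclid.
Variable R : realType.

Let dot_gt0 (x : R) : x != 0 -> 0 < x * x.
Proof. by move=> x0; rewrite -expr2 exprn_even_gt0. Qed.

Let enorm_equiv : exists2 c : R, 0 < c &
  forall x : R^o, `|x| <= c * `|x| /\ `|x| <= c * `|x|.
Proof. by exists 1 => // x; rewrite mul1r. Qed.

HB.instance Definition _ := @NormedModule_isEuclid.Build R R^o
  (fun x y => x * y) (@mulrC R) (fun x y z => mulrDl x y z)
  (fun a x y => esym (mulrA a x y)) dot_gt0
  (fun x => `|x|) (@ler_normD R R) (fun a x => normrM a x) enorm_equiv.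

End real_euclid.

Section rowvector_euclid.
Variables (R : realType) (n : nat).
Implicit Types x y z : 'rV[R]_n.

Definition row_dot x y : R := \sum_(i < n) x 0 i * y 0 i.
Definition row_enorm x : R := Num.sqrt (\sum_(i < n) x 0 i ^+ 2).

Let row_dotC x y : row_dot x y = row_dot y x.
Proof. by apply: eq_bigr => i _; rewrite mulrC. Qed.

Let row_dotDl x y z : row_dot (x + y) z = row_dot x z + row_dot y z.
Proof.
by rewrite /row_dot -big_split; apply: eq_bigr => i _; rewrite mxE mulrDl.
Qed.

Let row_dotZl a x y : row_dot (a *: x) y = a * row_dot x y.
Proof.
by rewrite /row_dot mulr_sumr; apply: eq_bigr => i _; rewrite mxE mulrA.
Qed.

Let row_dot_ge0 x : 0 <= row_dot x x.
Proof. by apply: sumr_ge0 => i _; rewrite -expr2 sqr_ge0. Qed.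

Let row_dot_gt0 x : x != 0 -> 0 < row_dot x x.
Proof.
move=> x0; rewrite lt_def row_dot_ge0 andbT.
apply: contraNneq x0 => /eqP; rewrite psumr_eq0; last first.
  by move=> i _; rewrite -expr2 sqr_ge0.
move=> /allP xi0; apply/eqP/rowP => i; rewrite mxE.
have /implyP/(_ isT) := xi0 i (mem_index_enum i).
by rewrite -expr2 sqrf_eq0 => /eqP.
Qed.

Let row_enormE x : row_enorm x = Num.sqrt (row_dot x x).
Proof. by congr Num.sqrt; apply: eq_bigr => i _; rewrite expr2. Qed.

Let row_enorm_sqr x : row_enorm x ^+ 2 = row_dot x x.
Proof. by rewrite row_enormE sqr_sqrtr. Qed.

Let row_enormZ a x : row_enorm (a *: x) = `|a| * row_enorm x.
Proof.
by rewrite !row_enormE row_dotZl row_dotC row_dotZl mulrA -expr2 sqrtrM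
  ?sqr_ge0// sqrtr_sqr.
Qed.

Let row_CauchySchwarz x y : row_dot x y ^+ 2 <= row_dot x x * row_dot y y.
Proof.
have [->|y0] := eqVneq y 0.
  rewrite -(scale0r (0 : 'rV[R]_n)) row_dotC !row_dotZl.
  by rewrite !mul0r mulr0 expr2 mul0r.
have yy := row_dot_gt0 y0.
have := row_dot_ge0 (row_dot y y *: x + (- row_dot x y) *: y).
rewrite row_dotDl !row_dotZl (row_dotC x) (row_dotC y (_ + _)).
rewrite !row_dotDl !row_dotZl (row_dotC y x).
set a := row_dot x x; set b := row_dot y y in yy *; set c := row_dot x y.
move=> h; have : 0 <= b * (a * b - c ^+ 2).
  by apply: le_trans h _; rewrite le_eqVlt; apply/orP; left; apply/eqP; ring.
by rewrite pmulr_rge0// subr_ge0.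
Qed.

Let row_enormD x y : row_enorm (x + y) <= row_enorm x + row_enorm y.
Proof.
have h0 z : 0 <= row_enorm z by rewrite row_enormE sqrtr_ge0.
rewrite -(ler_pXn2r (ltn0Sn 1)) ?nnegrE ?addr_ge0//.
rewrite sqrrD !row_enorm_sqr row_dotDl !(row_dotC _ (x + y)) !row_dotDl.
have : row_dot x y <= row_enorm x * row_enorm y.
  rewrite (le_trans (ler_norm _))//.
  rewrite -(ler_pXn2r (ltn0Sn 1)) ?nnegrE ?mulr_ge0//.
  by rewrite exprMn !row_enorm_sqr -normrX ger0_norm ?sqr_ge0.
rewrite (row_dotC y x) -mulr_natr; lra.
Qed.

Let row_enorm_equiv : exists2 c : R, 0 < c &
  forall x, `|x| <= c * row_enorm x /\ row_enorm x <= c * `|x|.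
Proof.
exists n.+1%:R => // x.
have h0 : 0 <= row_enorm x by rewrite row_enormE sqrtr_ge0.
have n1 : 1 <= n.+1%:R :> R by rewrite ler1n.
split.
  rewrite (@le_trans _ _ (row_enorm x)) ?ler_peMl//.
  rewrite [leLHS]mx_normrE; apply: bigmax_le => // -[i j] _ /=.
  rewrite ord1 -(ler_pXn2r (ltn0Sn 1)) ?nnegrE// row_enorm_sqr.
  rewrite /row_dot (bigD1 j)//= -normrX ger0_norm ?sqr_ge0// expr2 lerDl.
  by apply: sumr_ge0 => k _; rewrite -expr2 sqr_ge0.
rewrite -(ler_pXn2r (ltn0Sn 1)) ?nnegrE ?mulr_ge0// row_enorm_sqr.
apply: (@le_trans _ _ (\sum_(i < n) `|x| ^+ 2)).
  apply: ler_sum => j _; rewrite -expr2 -real_normK ?num_real//.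
  rewrite ler_pXn2r ?nnegrE//.
  rewrite [leRHS]mx_normrE.
  exact: (@le_bigmax _ _ _ _ (fun i => `|x i.1 i.2|) (0, j)).
rewrite sumr_const card_ord exprMn -[leLHS]mulr_natl.
rewrite ler_wpM2r ?sqr_ge0//.
rewrite (@le_trans _ _ n.+1%:R) ?ler_nat// expr2 ler_peMl//.
Qed.

HB.instance Definition _ := @NormedModule_isEuclid.Build R 'rV[R]_n
  row_dot row_dotC row_dotDl row_dotZl row_dot_gt0
  row_enorm row_enormD row_enormZ row_enorm_equiv.

End rowvector_euclid.

Section prod_euclid.
Variables (R : realType) (U V : euclidType R).
Implicit Types x y z : U * V.

Definition prod_dot x y : R := dot x.1 y.1 + dot x.2 y.2.
Definition prod_enorm x : R := enorm x.1 + enorm x.2.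

Let prod_dotC x y : prod_dot x y = prod_dot y x.
Proof. by rewrite /prod_dot dotC (dotC x.2). Qed.

Let prod_dotDl x y z : prod_dot (x + y) z = prod_dot x z + prod_dot y z.
Proof. by rewrite /prod_dot !dotDl addrACA. Qed.

Let prod_dotZl a x y : prod_dot (a *: x) y = a * prod_dot x y.
Proof. by rewrite /prod_dot !dotZl mulrDr. Qed.

Let dot_ge0 (W : euclidType R) (w : W) : 0 <= dot w w.
Proof.
have [->|/dot_gt0/ltW//] := eqVneq w 0.
by rewrite -(scale0r (0 : W)) dotZl mul0r.
Qed.

Let prod_dot_gt0 x : x != 0 -> 0 < prod_dot x x.
Proof.
case: x => u v; rewrite /prod_dot /=.
have [->|/dot_gt0 u0 _] := eqVneq u 0; last by rewrite ltr_pwDl.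
have [->|/dot_gt0 v0 _] := eqVneq v 0; last by rewrite ltr_wpDl.
by rewrite eqxx.
Qed.

Let prod_enormD x y : prod_enorm (x + y) <= prod_enorm x + prod_enorm y.
Proof. by rewrite /prod_enorm addrACA lerD// ler_enormD. Qed.

Let prod_enormZ a x : prod_enorm (a *: x) = `|a| * prod_enorm x.
Proof. by rewrite /prod_enorm !enormZ mulrDr. Qed.

Let prod_enorm_equiv : exists2 c : R, 0 < c &
  forall x, `|x| <= c * prod_enorm x /\ prod_enorm x <= c * `|x|.
Proof.
have [c c0 cU] := @enorm_equiv R U; have [d d0 dV] := @enorm_equiv R V.
exists (c + d); first by rewrite addr_gt0.
case=> u v; rewrite /prod_enorm prod_normE /=.
have [u1 u2] := cU u; have [v1 v2] := dV v.
have eu : 0 <= enorm u by rewrite -(pmulr_rge0 _ c0) (le_trans _ u1).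
have ev : 0 <= enorm v by rewrite -(pmulr_rge0 _ d0) (le_trans _ v1).
split.
  by rewrite ge_max; apply/andP; split; nra.
rewrite mulrDl lerD//.
  by rewrite (le_trans u2)// ler_wpM2l ?le_max ?lexx// ltW.
by rewrite (le_trans v2)// ler_wpM2l ?le_max ?lexx ?orbT// ltW.
Qed.

HB.instance Definition _ := @NormedModule_isEuclid.Build R (U * V)%type
  prod_dot prod_dotC prod_dotDl prod_dotZl prod_dot_gt0
  prod_enorm prod_enormD prod_enormZ prod_enorm_equiv.

End prod_euclid.

Section variational_analysis.
Variable R : realType.
Implicit Types V W : euclidType R.

(* [ereal_inf set0 = +oo] *)
Definition dist V (z : V) (A : set V) : \bar R :=
  ereal_inf [set (enorm (a - z))%:E | a in A].

Definition locally_lipschitz V (f : V -> R) : Prop :=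
  forall x : V, exists L : R, exists2 U, nbhs x U &
    forall u v, U u -> U v -> `|f u - f v| <= L * enorm (u - v).

Definition locally_closed V (A : set V) : Prop :=
  forall x, A x -> exists U, [/\ nbhs x U, closed U & closed (A `&` U)].

Definition tangent_cone V (A : set V) (z : V) : set V :=
  [set d | exists (t : nat -> R) (u : nat -> V),
     [/\ forall k, 0 < t k, t k @[k --> \oo] --> 0, u k @[k --> \oo] --> d &
         forall k, A (z + t k *: u k)]].

Definition polar V (C : set V) : set V :=
  [set xi | forall d, C d -> dot xi d <= 0].

Definition regular_normal_cone V (A : set V) (z : V) : set V :=
  polar (tangent_cone A z).

Definition limiting_normal_cone V (A : set V) (z : V) : set V :=
  [set xi | exists (zk xik : nat -> V),
     [/\ forall k, A (zk k), zk k @[k --> \oo] --> z,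
         forall k, regular_normal_cone A (zk k) (xik k) &
         xik k @[k --> \oo] --> xi]].

Definition epi V (f : V -> R) : set (V * R^o) := [set p | f p.1 <= p.2].

Definition limiting_subdiff V (f : V -> R) (z : V) : set V :=
  [set xi | limiting_normal_cone (epi f) (z, f z) (xi, -1)].

Definition gph V W (Y : V -> set W) : set (V * W) := [set p | Y p.1 p.2].

Definition dom V W (Y : V -> set W) : set V := [set z | Y z !=set0].

Definition inv_map V W (Y : V -> set W) (w : W) : set V := [set z | Y z w].

Definition coderivative V W (Y : V -> set W) (p : V * W) (eta : W) : set V :=
  [set xi | limiting_normal_cone (gph Y) p (xi, - eta)].

Definition metrically_subregular V W (Y : V -> set W) (p : V * W) : Prop :=
  gph Y p /\
  exists2 kappa : R, 0 < kappa &
    \forall z \near p.1,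
      (dist z (inv_map Y p.2) <= kappa%:E * dist p.2 (Y z))%E.

Definition inner_semicompact V W (Y : V -> set W) (z : V) (Omega : set V) :
    Prop :=
  dom Y z /\
  forall zk : nat -> V, (forall k, Omega (zk k)) -> zk k @[k --> \oo] --> z ->
    exists (phi : nat -> nat) (w : nat -> W),
      [/\ increasing_seq phi, cvgn w & forall l, Y (zk (phi l)) (w l)].

Definition msum V (A B : set V) : set V := [set a + b | a in A & b in B].

End variational_analysis.

Section problem.
Variables (R : realType) (n m s : nat).
Variables (f : 'rV[R]_n -> R) (F : 'rV[R]_n -> set 'rV[R]_m).
Variables (G : 'rV[R]_n * 'rV[R]_m -> set 'rV[R]_s) (M : set 'rV[R]_n).

Definition Hmap (z : 'rV[R]_n) : set 'rV[R]_s :=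
  \bigcup_(lam in F z) G (z, lam).

Definition Kmap (z : 'rV[R]_n) : set 'rV[R]_m :=
  [set lam | F z lam /\ G (z, lam) 0].

Definition feasible (z : 'rV[R]_n) : Prop := Hmap z 0 /\ M z.

Definition implicitly_M_stationary (z : 'rV[R]_n) : Prop :=
  feasible z /\
  exists nu : 'rV[R]_s,
    msum (msum (limiting_subdiff f z) (coderivative Hmap (z, 0) nu))
         (limiting_normal_cone M z) 0.

Definition explicitly_M_stationary (z : 'rV[R]_n) : Prop :=
  feasible z /\
  exists (lam mu : 'rV[R]_m) (nu : 'rV[R]_s),
    Kmap z lam /\
    msum (msum (msum (limiting_subdiff f z) (coderivative F (z, lam) mu))
               [set xi | coderivative G ((z, lam), 0) nu (xi, mu)])
         (limiting_normal_cone M z) 0.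

Definition intermediate_map (p : 'rV[R]_n * 'rV[R]_s) :
    set ('rV[R]_n * 'rV[R]_m) :=
  [set q | q.1 = p.1 /\ F p.1 q.2 /\ G (p.1, q.2) p.2].

Definition feasibility_map (x : 'rV[R]_n * 'rV[R]_s * 'rV[R]_n * 'rV[R]_m) :
    set ('rV[R]_n * 'rV[R]_m * 'rV[R]_s) :=
  let: (z, w, q, lam) := x in
  [set (z - q, a - lam, b - w) | a in F z & b in G (q, lam)].

End problem.

(* Main.v *)
(* Let (xi, -nu) be a limiting normal to gph H at (zbar, 0), approximated by
   regular normals at points (z_k, w_k).  Inner semicompactness provides
   multipliers lam_k converging to some lam in K(zbar).  Subregularity at
   (zbar, 0, zbar, lam) turns the regular normal inequality at (z_k, w_k) into an
   exact penalty: with e = (z, beta) in gph F and ((q, lam'), w) in gph G, the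
   function K * |e - e'| - <xi_k, z> + <nu_k, w>, where e' = (q, lam'), has, up to
   a term of arbitrarily small slope, a local minimizer at e = e' = (z_k, lam_k),
   w = w_k, with K independent of k.  Replacing each norm by the smooth function
   sqrt (|x|^2 + d^2) yields nearby minimizers at which Fermat's rule splits into
   one regular normal for gph F and one for gph G, linked by a common multiplier
   alpha of norm at most K.  A cluster point (alpha1, mu) of these multipliers
   gives (xi - alpha1, -mu) in N_gphF and (alpha1, mu, -nu) in N_gphG. *)
Require Import Defs.
From mathcomp Require Import all_boot all_order all_algebra.
From mathcomp Require Import all_classical all_reals all_analysis.
From mathcomp Require Import ring lra.

Set Implicit Arguments.
Unset Strict Implicit.

Import Order.TTheory GRing.Theory Num.Theory.
Import numFieldNormedType.Exports.
Local Open Scope classical_set_scope.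
Local Open Scope ring_scope.

(** * Inner products and the norm they induce *)

Section inner_product.
Variables (R : realType) (V : euclidType R).
Implicit Types x y z : V.

Lemma dot0l x : dot 0 x = 0.
Proof. by rewrite -(scale0r (0 : V)) dotZl mul0r. Qed.

Lemma dotNl x y : dot (- x) y = - dot x y.
Proof. by rewrite -scaleN1r dotZl mulN1r. Qed.

Lemma dotBl x y z : dot (x - y) z = dot x z - dot y z.
Proof. by rewrite dotDl dotNl. Qed.

Lemma dotDr x y z : dot x (y + z) = dot x y + dot x z.
Proof. by rewrite dotC dotDl !(dotC x). Qed.

Lemma dotZr a x y : dot x (a *: y) = a * dot x y.
Proof. by rewrite dotC dotZl dotC. Qed.

Lemma dotNr x y : dot x (- y) = - dot x y.
Proof. by rewrite dotC dotNl dotC. Qed.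

Lemma dotBr x y z : dot x (y - z) = dot x y - dot x z.
Proof. by rewrite dotDr dotNr. Qed.

Lemma dot_ge0 x : 0 <= dot x x.
Proof. by have [->|/dot_gt0/ltW//] := eqVneq x 0; rewrite dot0l. Qed.

(** On products [enorm] is the sum of the component norms, which the inner product does not induce
    in general; Cauchy-Schwarz and the smoothing below need the induced norm. *)
Definition dotnorm x : R := Num.sqrt (dot x x).

Lemma dotnorm_ge0 x : 0 <= dotnorm x.
Proof. exact: sqrtr_ge0. Qed.

Lemma dotnorm_sqr x : dotnorm x ^+ 2 = dot x x.
Proof. by rewrite sqr_sqrtr// dot_ge0. Qed.

Lemma ler_dot_dotnorm x y : dot x y <= dotnorm x * dotnorm y.
Proof.
have [->|/dot_gt0 y0] := eqVneq y 0.
  by rewrite dotC dot0l mulr_ge0 ?dotnorm_ge0.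
have := dot_ge0 (dot y y *: x - dot x y *: y).
rewrite !(dotBl, dotBr, dotZl, dotZr) (dotC y x) => h.
have {}h : dot x y ^+ 2 <= dot x x * dot y y.
  by rewrite -subr_ge0 -(pmulr_rge0 _ y0); move: h; congr (0 <= _); ring.
have [xy0|xy0] := leP (dot x y) 0.
  by rewrite (le_trans xy0)// mulr_ge0 ?dotnorm_ge0.
by rewrite -(ler_pXn2r (ltn0Sn 1)) ?nnegrE ?mulr_ge0 ?dotnorm_ge0 ?(ltW xy0)//
  exprMn !dotnorm_sqr.
Qed.

Lemma ler_norm_dot x y : `|dot x y| <= dotnorm x * dotnorm y.
Proof.
rewrite ler_norml ler_dot_dotnorm andbT lerNl -dotNl.
by rewrite (le_trans (ler_dot_dotnorm _ _))// /dotnorm dotNl dotNr opprK.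
Qed.

Lemma enorm0 : enorm (0 : V) = 0.
Proof. by rewrite -(scale0r (0 : V)) enormZ normr0 mul0r. Qed.

Lemma enormN x : enorm (- x) = enorm x.
Proof. by rewrite -scaleN1r enormZ normrN1 mul1r. Qed.

Lemma enorm_ge0 x : 0 <= enorm x.
Proof.
have [c c0 /(_ x)[h _]] := @enorm_equiv R V.
by rewrite -(pmulr_rge0 _ c0) (le_trans _ h).
Qed.

(* The axioms of [euclidType] allow inner products that are not continuous and
   spaces that are not finite-dimensional; this excludes both. *)
Definition euclidean : Prop :=
  (exists2 c : R, 0 < c &
     forall x, `|x| <= c * dotnorm x /\ dotnorm x <= c * `|x|) /\
  (forall x r, compact (closed_ball_ Num.norm x r)).

Lemma cvg_dot (T : Type) (F : set_system T) (FF : Filter F) (u v : T -> V)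
    (a b : V) : euclidean -> u t @[t --> F] --> a -> v t @[t --> F] --> b ->
  dot (u t) (v t) @[t --> F] --> dot a b.
Proof.
move=> [[c c0 cV] _] ua vb; apply/subr_cvg0/norm_cvg0P.
have u0 : `|u t - a| @[t --> F] --> 0.
  by rewrite -(normr0 V); apply: cvg_norm; apply/subr_cvg0.
have v0 : `|v t - b| @[t --> F] --> 0.
  by rewrite -(normr0 V); apply: cvg_norm; apply/subr_cvg0.
have h t : 0 <= `|dot (u t) (v t) - dot a b| <=
    c * `|u t - a| * (c * `|v t|) + c * `|a| * (c * `|v t - b|).
  rewrite normr_ge0/= (_ : _ - _ = dot (u t - a) (v t) + dot a (v t - b)).
    rewrite (le_trans (ler_normD _ _))// lerD//;
      rewrite (le_trans (ler_norm_dot _ _))// ler_pM ?dotnorm_ge0//.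
    - by have [] := cV (u t - a).
    - by have [] := cV (v t).
    - by have [] := cV a.
    - by have [] := cV (v t - b).
  by rewrite dotBl dotBr addrA subrK.
apply: squeeze_cvgr (cvg_cst 0) _.
  by apply: nearW => t; exact: h.
rewrite [X in _ --> X](_ : _ = c * 0 * (c * `|b|) + c * `|a| * (c * 0));
  last by ring.
apply: cvgD; apply: cvgM; try exact: cvg_cst.
- by apply: cvgM => //; exact: cvg_cst.
- by apply: cvgM; [exact: cvg_cst|exact: cvg_norm].
- by apply: cvgM => //; exact: cvg_cst.
Qed.

End inner_product.

(** * Row vectors and products as Euclidean spaces *)

Section euclidean_spaces.
Variable R : realType.

Lemma row_dotnormE n (x : 'rV[R]_n) : dotnorm x = enorm x.
Proof. by congr Num.sqrt; apply: eq_bigr => i _; rewrite expr2. Qed.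

Lemma euclidean_row n : @euclidean R 'rV[R]_n.
Proof.
split=> [|x r].
  by have [c c0 h] := @enorm_equiv R 'rV[R]_n; exists c => // x;
    rewrite row_dotnormE.
apply: bounded_closed_compact; last first.
  by apply: closed_closed_ball_.
exists (`|x| + r); split; first exact: num_real.
move=> M xM y /= xy; apply: le_trans (ltW xM).
by rewrite -lerBlDl (le_trans _ xy)// distrC lerB_dist.
Qed.

Lemma euclidean_prod (U V : euclidType R) :
  euclidean U -> euclidean V -> euclidean (U * V)%type.
Proof.
move=> [[c c0 cU] kU] [[d d0 dV] kV]; split=> [|[x y] r]; last first.
  rewrite (_ : closed_ball_ _ _ _ =
    closed_ball_ Num.norm x r `*` closed_ball_ Num.norm y r).
    exact: compact_setX.
  apply/seteqP; split=> -[u v]; rewrite /closed_ball_ /= prod_normE /= ge_max.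
    by move=> /andP.
  by move=> [-> ->].
exists (c + d); first exact: addr_gt0.
case=> x y; have [x1 x2] := cU x; have [y1 y2] := dV y.
have xxy : dotnorm x <= dotnorm (x, y).
  by rewrite ler_wsqrtr// /dot/= /prod_dot lerDl dot_ge0.
have yxy : dotnorm y <= dotnorm (x, y).
  by rewrite ler_wsqrtr// /dot/= /prod_dot lerDr dot_ge0.
have dx := dotnorm_ge0 x; have dy := dotnorm_ge0 y.
rewrite prod_normE /=; split.
  by rewrite ge_max; apply/andP; split; nra.
apply: (@le_trans _ _ (dotnorm x + dotnorm y)).
  rewrite -(ler_pXn2r (ltn0Sn 1)) ?nnegrE ?addr_ge0 ?dotnorm_ge0//.
  rewrite dotnorm_sqr sqrrD !dotnorm_sqr.
  rewrite [leLHS](_ : _ = dot x x + dot y y)// addrAC lerDl.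
  by rewrite mulrn_wge0// mulr_ge0.
have mx : `|x| <= Num.max `|x| `|y| by rewrite le_max lexx.
have my : `|y| <= Num.max `|x| `|y| by rewrite le_max lexx orbT.
by rewrite mulrDl lerD//; [apply: le_trans x2 _|apply: le_trans y2 _];
  rewrite ler_wpM2l// ltW.
Qed.

End euclidean_spaces.

(** * Tangent directions, regular and limiting normals, Fermat's rule *)

Section cones.
Variable R : realType.
Implicit Types V W : euclidType R.

Lemma cvg_natSinv_dist (V : normedModType R) (u : nat -> V) (a : V) :
  (forall k, `|u k - a| < k.+1%:R^-1) -> u k @[k --> \oo] --> a.
Proof.
move=> ua; apply/cvgrPdist_lt => e e0; near=> k.
rewrite distrC (lt_trans (ua k))//; near: k.
exact: (near_infty_natSinv_lt (PosNum e0)).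
Unshelve. all: by end_near. Qed.

(** Countable choice along the radii 1/(k+1) turns an epsilon condition into the sequences of the
    definition. *)
Lemma tangent_coneI V (A : set V) (z d : V) :
  (forall e, 0 < e -> exists t u, [/\ 0 < t, t < e, `|u - d| < e &
     A (z + t *: u)]) ->
  tangent_cone A z d.
Proof.
move=> h; have {h} /choice[s hs] k : exists s : R * V,
    [/\ 0 < s.1, s.1 < k.+1%:R^-1, `|s.2 - d| < k.+1%:R^-1 &
     A (z + s.1 *: s.2)].
  by have [|t [u tu]] := h k.+1%:R^-1; [rewrite invr_gt0|exists (t, u)].
exists (fst \o s), (snd \o s); split=> [k||| k] /=.
- by have [] := hs k.
- by apply: cvg_natSinv_dist => k; rewrite subr0 gtr0_norm;
    have [] := hs k.
- by apply: cvg_natSinv_dist => k; have [] := hs k.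
- by have [] := hs k.
Qed.

Lemma limiting_normal_coneI V (A : set V) (z xi : V) :
  (forall e, 0 < e -> exists z' xi', [/\ A z', `|z' - z| < e,
     regular_normal_cone A z' xi' & `|xi' - xi| < e]) ->
  limiting_normal_cone A z xi.
Proof.
move=> h; have {h} /choice[s hs] k : exists s : V * V,
    [/\ A s.1, `|s.1 - z| < k.+1%:R^-1,
     regular_normal_cone A s.1 s.2 & `|s.2 - xi| < k.+1%:R^-1].
  by have [|z' [x' h']] := h k.+1%:R^-1; [rewrite invr_gt0|exists (z', x')].
exists (fst \o s), (snd \o s); split=> [k|| k|] /=.
- by have [] := hs k.
- by apply: cvg_natSinv_dist => k; have [] := hs k.
- by have [] := hs k.
- by apply: cvg_natSinv_dist => k; have [] := hs k.
Qed.

(** Arbitrarily late terms close to a cluster point stand in for a convergent subsequence. *)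
Lemma compact_cluster_seq (V : normedModType R) (K : set V) (u : nat -> V) :
  compact K -> (forall k, K (u k)) ->
  exists2 a, K a & forall e N, 0 < e -> exists2 k, (N <= k)%N & `|u k - a| < e.
Proof.
move=> cK uK; have [|a [Ka ca]] := cK (u @ \oo) _.
  by exists 0%N => // k _; exact: uK.
exists a => // e N e0.
have [_ [[k Nk <-] ak]] := ca (u @` [set k | (N <= k)%N]) (ball a e)
  ltac:(by exists N => // k Nk /=; exists k) (nbhsx_ballx _ _ e0).
by exists k => //; move: ak; rewrite -ball_normE /= distrC.
Qed.

(** Otherwise points [x k] of [A] approach [z] and violate the estimate. Their normalized directions
    [u k] cluster, by compactness of the unit ball, at a tangent direction [d]; then [dot xi d <= 0]
    contradicts [e < dot xi (u k)] for [u k] close to [d]. *)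
Lemma regular_normal_cone_le V (A : set V) (z xi : V) : euclidean V ->
  regular_normal_cone A z xi -> forall e, 0 < e ->
  exists2 r, 0 < r & forall x, A x -> `|x - z| < r ->
    dot xi (x - z) <= e * `|x - z|.
Proof.
move=> eV; have [[c c0 cV] kV] := eV; move=> xiN e e0; apply: contrapT => h.
have {h} /choice[x hx] k : exists x, [/\ A x, `|x - z| < k.+1%:R^-1 &
    e * `|x - z| < dot xi (x - z)].
  apply: contrapT => h'; apply: h; exists k.+1%:R^-1.
    by rewrite invr_gt0 ltr0n.
  by move=> x Ax xz; rewrite leNgt; apply/negP => ?; apply: h'; exists x.
pose t k := `|x k - z|; pose u k := (t k)^-1 *: (x k - z).
have t0 k : 0 < t k.
  rewrite normr_gt0; apply/eqP => xz.
  by have [_ _] := hx k; rewrite xz dotC dot0l normr0 mulr0 ltxx.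
have xE k : x k = z + t k *: u k.
  by rewrite scalerA divff ?gt_eqF// scale1r addrC subrK.
have eu k : e < dot xi (u k).
  have [_ _] := hx k; rewrite -/(t k) dotZr.
  by rewrite [_^-1 * _]mulrC ltr_pdivlMr.
have [k|d _ du] := compact_cluster_seq (u := u) (kV 0 1).
  rewrite /closed_ball_ /= sub0r normrN normrZ normfV normr_id mulVf//.
  by rewrite gt_eqF// t0.
have {xiN} : dot xi d <= 0.
  apply: xiN; apply: tangent_coneI => r r0.
  have [N _ Nr] := near_infty_natSinv_lt (PosNum r0).
  have [k Nk kr] := du r N r0; exists (t k), (u k); split=> //.
    by have [_ /lt_trans xk _] := hx k; apply: xk; exact: Nr.
  by rewrite -xE; have [] := hx k.
(* A Lipschitz constant of [dot xi] for the ambient norm; the summand 1 keeps it positive when [xi]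
   is 0. *)
pose M := dotnorm xi * c + 1.
have M0 : 0 < M.
  rewrite ltr_wpDl//; apply: mulr_ge0; first exact: dotnorm_ge0.
  exact: ltW.
have [k _ kM] := du (e / M) 0%N (divr_gt0 e0 M0).
have := eu k; rewrite -[u k](subrK d) dotDr.
move=> h1 h2; have : e < e.
  apply: (lt_trans h1); rewrite (@le_lt_trans _ _ (dot xi (u k - d)))//.
    by rewrite gerDl.
  rewrite (le_lt_trans (ler_dot_dotnorm _ _))//.
  rewrite (@le_lt_trans _ _ (dotnorm xi * c * `|u k - d|))//.
    by rewrite -mulrA ler_wpM2l ?dotnorm_ge0//; have [] := cV (u k - d).
  rewrite (@le_lt_trans _ _ (M * `|u k - d|))//.
    by rewrite ler_wpM2r// lerDl.
  by rewrite mulrC -ltr_pdivlMr.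
by rewrite ltxx.
Qed.

(* [g] is a gradient of [phi] at [p] as far as upper estimates go, which is all
   that Fermat's rule needs. *)
Definition upper_gradient V (phi : V -> R) (p g : V) : Prop :=
  exists2 c, 0 <= c & forall t u,
    phi (p + t *: u) <= phi p + t * dot g u + c * t ^+ 2 * dot u u.

(** Fermat's rule: along a tangent sequence, minimality and the upper estimate, divided by [t k],
    give [0 <= dot g (u k) + c * t k * dot (u k) (u k)], which tends to [dot g d]. *)
Lemma regular_normal_cone_local_min V (A : set V) (phi : V -> R) (p g : V) :
  euclidean V -> upper_gradient phi p g ->
  (\forall x \near p, A x -> phi p <= phi x) ->
  regular_normal_cone A p (- g).
Proof.
move=> eV [c c0 phig] pmin d [t [u [t0 tc uc Au]]].
rewrite dotNl oppr_le0.
have xc : p + t k *: u k @[k --> \oo] --> p.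
  rewrite -[X in _ --> X]addr0 -(scale0r d).
  by apply: cvgD; [exact: cvg_cst|exact: cvgZ].
have lim : dot g (u k) + c * t k * dot (u k) (u k) @[k --> \oo] --> dot g d.
  rewrite -[X in _ --> X]addr0 -(mul0r (dot d d)) -(mulr0 c).
  apply: cvgD; first by apply: cvg_dot => //; exact: cvg_cst.
  apply: cvgM; last exact: cvg_dot.
  by apply: cvgM => //; exact: cvg_cst.
apply: (cvgr_to_ge lim); near=> k.
have /(_ (Au k)) pk : A (p + t k *: u k) -> phi p <= phi (p + t k *: u k).
  by near: k; exact: (xc _ pmin).
have := le_trans pk (phig _ _).
rewrite -addrA lerDl.
rewrite (_ : _ + _ = t k * (dot g (u k) + c * t k * dot (u k) (u k))).
  by rewrite pmulr_rge0.
by ring.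
Unshelve. all: by end_near. Qed.
End cones.

(** * Calculus of upper gradients *)

Section upper_gradient_calculus.
Variables (R : realType) (V : euclidType R).
Implicit Types (phi psi : V -> R) (p q g h : V).

Lemma upper_gradientD phi psi p g h :
  upper_gradient phi p g -> upper_gradient psi p h ->
  upper_gradient (fun x => phi x + psi x) p (g + h).
Proof.
move=> [c c0 phig] [d d0 psih]; exists (c + d); first exact: addr_ge0.
move=> t u; apply: le_trans (lerD (phig t u) (psih t u)) _.
by rewrite le_eqVlt dotDl; apply/orP; left; apply/eqP; ring.
Qed.

Lemma upper_gradientZ a phi p g : 0 <= a ->
  upper_gradient phi p g -> upper_gradient (fun x => a * phi x) p (a *: g).
Proof.
move=> a0 [c c0 phig]; exists (a * c); first exact: mulr_ge0.
move=> t u; apply: le_trans (ler_wpM2l a0 (phig t u)) _.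
by rewrite le_eqVlt dotZl; apply/orP; left; apply/eqP; ring.
Qed.

Lemma upper_gradient_subr phi p q g :
  upper_gradient phi (p - q) g -> upper_gradient (fun x => phi (x - q)) p g.
Proof. by move=> [c c0 phig]; exists c => // t u; rewrite addrAC. Qed.

Lemma upper_gradient_subl phi p q g :
  upper_gradient phi (q - p) g ->
  upper_gradient (fun x => phi (q - x)) p (- g).
Proof.
move=> [c c0 phig]; exists c => // t u; have := phig t (- u).
by rewrite opprD addrA scalerN !dotNr !dotNl opprK.
Qed.

Lemma upper_gradient_affine q p g : upper_gradient (fun x => dot g (x - q)) p g.
Proof.
by exists 0 => // t u; rewrite !mul0r addr0 (addrAC p) (dotDr g (p - q)) dotZr.
Qed.

Lemma upper_gradient_cst a p : upper_gradient (fun=> a) p 0.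
Proof. by exists 0 => // t u; rewrite dot0l mulr0 !mul0r !addr0. Qed.

End upper_gradient_calculus.

Lemma upper_gradient_fst (R : realType) (U V : euclidType R) (phi : U -> R)
    (p : U * V) (g : U) : upper_gradient phi p.1 g ->
  upper_gradient (fun x : U * V => phi x.1) p ((g, 0) : U * V).
Proof.
move=> [c c0 phig]; exists c => // t u /=; apply: le_trans (phig t u.1) _.
rewrite /dot/= /prod_dot/= dot0l addr0 lerD2l ler_wpM2l//.
  by rewrite mulr_ge0// sqr_ge0.
by rewrite lerDl dot_ge0.
Qed.

Lemma upper_gradient_snd (R : realType) (U V : euclidType R) (phi : V -> R)
    (p : U * V) (g : V) : upper_gradient phi p.2 g ->
  upper_gradient (fun x : U * V => phi x.2) p ((0, g) : U * V).
Proof.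
move=> [c c0 phig]; exists c => // t u /=; apply: le_trans (phig t u.2) _.
rewrite /dot/= /prod_dot/= dot0l add0r lerD2l ler_wpM2l//.
  by rewrite mulr_ge0// sqr_ge0.
by rewrite lerDr dot_ge0.
Qed.

(** * Smoothing of the norm *)

Section smoothed_norm.
Variables (R : realType) (V : euclidType R).
Implicit Types (d : R) (x : V).

Definition smooth_norm d x : R := Num.sqrt (dot x x + d ^+ 2).

Lemma smooth_norm0 d : 0 <= d -> smooth_norm d 0 = d.
Proof. by move=> d0; rewrite /smooth_norm dot0l add0r sqrtr_sqr ger0_norm. Qed.

Lemma dotnorm_le_smooth d x : dotnorm x <= smooth_norm d x.
Proof. by rewrite ler_wsqrtr// lerDl sqr_ge0. Qed.

Lemma smooth_norm_gt0 d x : 0 < d -> 0 < smooth_norm d x.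
Proof. by move=> d0; rewrite sqrtr_gt0 ltr_wpDl ?dot_ge0 ?exprn_gt0. Qed.

(** With [s] and [s'] the values at [x] and at the displaced point, the upper estimate exceeds [s']
    by exactly (s' - s)^2 / (2 s). *)
Lemma upper_gradient_smooth d x : 0 < d ->
  upper_gradient (smooth_norm d) x ((smooth_norm d x)^-1 *: x).
Proof.
move=> d0; set s := smooth_norm d x; have s0 : 0 < s by exact: smooth_norm_gt0.
exists ((2 * s)^-1); first by rewrite invr_ge0 mulr_ge0// ltW.
move=> t u; set s' := smooth_norm d _.
have sE : s ^+ 2 = dot x x + d ^+ 2.
  by rewrite sqr_sqrtr// addr_ge0 ?dot_ge0 ?sqr_ge0.
have : s' ^+ 2 = s ^+ 2 + 2 * t * dot x u + t ^+ 2 * dot u u.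
  rewrite sE sqr_sqrtr; last by rewrite addr_ge0 ?dot_ge0 ?sqr_ge0.
  by rewrite !(dotDl, dotDr, dotZl, dotZr) (dotC u x); ring.
move=> s'E; rewrite dotZl -subr_ge0.
rewrite [leRHS](_ : _ = (s' - s) ^+ 2 / (2 * s)).
  by rewrite divr_ge0 ?sqr_ge0 ?mulr_ge0 ?(ltW s0).
rewrite -/s sqrrB s'E; field.
by rewrite gt_eqF.
Qed.

Lemma dotnorm_gradient_smooth d x : 0 < d ->
  dotnorm ((smooth_norm d x)^-1 *: x) <= 1.
Proof.
move=> d0; have s0 := smooth_norm_gt0 x d0.
rewrite /dotnorm dotZl dotZr mulrA -expr2 sqrtrM ?sqr_ge0// sqrtr_sqr.
rewrite ger0_norm ?invr_ge0 ?(ltW s0)// ler_pdivrMl// mulr1.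
exact: dotnorm_le_smooth.
Qed.

Lemma continuous_smooth_norm d : euclidean V -> continuous (smooth_norm d).
Proof.
move=> eV x; apply: continuous_comp; last exact: sqrt_continuous.
apply: cvgD; last exact: cvg_cst.
by apply: cvg_dot.
Qed.

End smoothed_norm.

(** * Coupled sets: exact penalization, common multipliers, passage to the limit *)

Lemma nbhs_closed_ball_ (R : realType) (V : normedModType R) (x0 x : V)
    (r : R) :
  `|x - x0| < r -> \forall y \near x, closed_ball_ Num.norm x0 r y.
Proof.
move=> xr; near=> y; rewrite /closed_ball_ /= -(subrK x x0) -addrA.
rewrite (le_trans (ler_normD _ _))// distrC -lerBrDl ltW//.
near: y; apply: cvgr_dist_lt; first exact: cvg_id.
by rewrite subr_gt0.
Unshelve. all: by end_near. Qed.

(** Exact penalization of the constraint e = e': up to slope [eps], the base point locally minimizes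
    [K * dotnorm (e - e')] minus the linear form given by [zeta] and [omega], with [e] and [(e', w)]
    ranging independently over [A] and [B]. *)
Definition exact_coupling (R : realType) (E W : euclidType R)
    (A : set E) (B : set (E * W)) (e0 : E) (w0 : W) (zeta : E) (omega : W)
    (K eps : R) : Prop :=
  exists2 r, 0 < r & forall e e' w, A e -> B (e', w) ->
    `|e - e0| < r -> `|e' - e0| < r -> `|w - w0| < r ->
    dot zeta (e - e0) + dot omega (w - w0) <= K * dotnorm (e - e') +
      eps * (dotnorm (e - e0) + dotnorm (e' - e0) + dotnorm (w - w0)).

Section penalization.
Variables (R : realType) (E W : euclidType R).
Variables (A : set E) (B : set (E * W)).
Variables (e0 zeta : E) (w0 omega : W) (K eps : R).
Hypotheses (eE : euclidean E) (eW : euclidean W).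
Hypotheses (A_closed : closed A) (B_closed : closed B).
Hypotheses (Ae0 : A e0) (Bw0 : B (e0, w0)) (K0 : 0 <= K) (eps0 : 0 < eps).

(* The [eps]-terms are twice as large as those in [exact_coupling]: the surplus
   forces minimizers close to [(e0, (e0, w0))] when [d] is small. *)
Let pen (d : R) (p : E * (E * W)) : R :=
  K * smooth_norm d (p.1 - p.2.1) +
  2 * eps * (smooth_norm d (p.1 - e0) + smooth_norm d (p.2.1 - e0) +
             smooth_norm d (p.2.2 - w0)) +
  (dot (- zeta) (p.1 - e0) + dot (- omega) (p.2.2 - w0)).

Let continuous_pen d : continuous (pen d).
Proof.
move=> p.
have c1 : (x : E * (E * W)).1 @[x --> p] --> p.1 by exact: cvg_fst.
have c2 : (x : E * (E * W)).2 @[x --> p] --> p.2 by exact: cvg_snd.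
have c21 : (x : E * (E * W)).2.1 @[x --> p] --> p.2.1.
  by apply: cvg_comp c2 _; exact: cvg_fst.
have c22 : (x : E * (E * W)).2.2 @[x --> p] --> p.2.2.
  by apply: cvg_comp c2 _; exact: cvg_snd.
have sm (V : euclidType R) (u v : E * (E * W) -> V) : euclidean V ->
    u x @[x --> p] --> u p -> v x @[x --> p] --> v p ->
    smooth_norm d (u x - v x) @[x --> p] --> smooth_norm d (u p - v p).
  move=> eV up vp.
  have uv : (u x - v x) @[x --> p] --> u p - v p by exact: cvgB.
  exact: (cvg_comp _ _ uv (@continuous_smooth_norm _ V d eV (u p - v p))).
apply: cvgD; [apply: cvgD|apply: cvgD].
- by apply: cvgM; [exact: cvg_cst|exact: sm].
- apply: cvgM; first exact: cvg_cst.
  by apply: cvgD; [apply: cvgD|]; apply: sm => //; exact: cvg_cst.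
- by apply: cvg_dot => //; [exact: cvg_cst|apply: cvgB => //; exact: cvg_cst].
- by apply: cvg_dot => //; [exact: cvg_cst|apply: cvgB => //; exact: cvg_cst].
Qed.

Hypothesis growth : exact_coupling A B e0 w0 zeta omega K eps.

(** Minimize [pen d] over compact pieces of [A] and [B] around the base point. For small [d] the
    minimizer is interior to the two balls, so Fermat's rule applies to [e] and to [(e', w)]
    separately. *)
Lemma penalized_multipliers (eta : R) : 0 < eta ->
  exists (e e' alpha u1 u2 : E) (w u3 : W),
  [/\ A e /\ B (e', w),
      [/\ `|e - e0| < eta, `|e' - e0| < eta & `|w - w0| < eta],
      [/\ dotnorm u1 <= 1, dotnorm u2 <= 1, dotnorm u3 <= 1 &
          dotnorm alpha <= K],
      regular_normal_cone A e (zeta - alpha - (2 * eps) *: u1) &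
      regular_normal_cone B (e', w)
        (alpha - (2 * eps) *: u2, omega - (2 * eps) *: u3)].
Proof.
move=> eta0; have [r r0 grow] := growth.
have [[cE cE0 hE] kE] := eE; have [[cW cW0 hW] kW] := eW.
have [[_ _ _] kEW] := euclidean_prod eE eW.
(* Halving keeps the closed balls strictly inside radii [r] and [eta]. At the base point [pen d]
   equals [d * C]: one coupling term and three terms with factor [2 * eps]. Below, [d] is chosen so
   that this is [eps * (rho / (2 * c))]. *)
pose rho := Num.min r eta / 2; pose C := K + 6 * eps; pose c := cE + cW.
have C0 : 0 < C by rewrite ltr_wpDl// mulr_gt0.
have c0 : 0 < c by exact: addr_gt0.
have m0 : 0 < Num.min r eta by rewrite lt_min r0.
have rho0 : 0 < rho by exact: divr_gt0.
have rho_m : rho < Num.min r eta.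
  by rewrite ltr_pdivrMr// ltr_pMr// ltr1n.
have [rho_r rho_eta] : rho < r /\ rho < eta.
  by apply/andP; rewrite -lt_min.
pose d := eps * (rho / (2 * c)) / C.
have d0 : 0 < d.
  by rewrite divr_gt0// mulr_gt0// divr_gt0// mulr_gt0.
have dC : d * C = eps * (rho / (2 * c)) by rewrite divfK// gt_eqF.
pose S := (A `&` closed_ball_ Num.norm e0 rho) `*`
  (B `&` closed_ball_ Num.norm ((e0, w0) : E * W) rho).
have cS : compact S.
  apply: compact_setX.
    apply: subclosed_compact (kE e0 rho) (@subIsetr _ _ _).
    by apply: closedI => //; exact: closed_closed_ball_.
  apply: subclosed_compact (kEW (e0, w0) rho) (@subIsetr _ _ _).
  by apply: closedI => //; exact: closed_closed_ball_.
have cen (V : normedModType R) (x : V) : closed_ball_ Num.norm x rho x.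
  by rewrite /closed_ball_ /= subrr normr0 ltW.
have S0 : S (e0, (e0, w0)) by split; split=> //; exact: cen.
have [[e [e' w]]] := compact_EVT_min (ex_intro _ _ S0) cS
  (continuous_subspaceT (@continuous_pen d)).
rewrite inE => -[/= [Ae e_rho] [Bw w_rho]] pmin.
have {}pmin p : S p -> pen d (e, (e', w)) <= pen d p.
  by move=> Sp; apply: pmin; rewrite inE.
have [e1 e2 e3] : [/\ `|e - e0| <= rho, `|e' - e0| <= rho & `|w - w0| <= rho].
  move: e_rho w_rho; rewrite /closed_ball_ /= prod_normE /= ge_max.
  by rewrite !(distrC _ e0) !(distrC _ w0) => -> /andP[-> ->].
(* By [grow], [pen d] at the minimizer is at least [eps] times the left-hand side, while minimality
   bounds it by [d * C]. *)
have small : dotnorm (e - e0) + dotnorm (e' - e0) + dotnorm (w - w0) <=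
    rho / (2 * c).
  rewrite -(ler_pM2l eps0) -dC.
  have := pmin _ S0; rewrite /pen /= !subrr !smooth_norm0 ?(ltW d0)//.
  rewrite !dotNl !(dotC _ 0) !dot0l.
  have := grow e e' w Ae Bw (le_lt_trans e1 rho_r) (le_lt_trans e2 rho_r)
    (le_lt_trans e3 rho_r).
  have := ler_wpM2l K0 (dotnorm_le_smooth d (e - e')).
  have := ler_wpM2l (ltW eps0) (dotnorm_le_smooth d (e - e0)).
  have := ler_wpM2l (ltW eps0) (dotnorm_le_smooth d (e' - e0)).
  have := ler_wpM2l (ltW eps0) (dotnorm_le_smooth d (w - w0)).
  rewrite /C; lra.
have near_rho (V : euclidType R) (x : V) cV : cV <= c ->
    `|x| <= cV * dotnorm x -> dotnorm x <= rho / (2 * c) -> `|x| < rho.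
  move=> cVc x1 x2; apply: le_lt_trans x1 _.
  apply: (@le_lt_trans _ _ (c * (rho / (2 * c)))).
    apply: le_trans (ler_wpM2r (dotnorm_ge0 _) cVc) _.
    by rewrite ler_wpM2l// ltW.
  rewrite (_ : c * _ = rho / 2); last by field; rewrite gt_eqF.
  by rewrite ltr_pdivrMr// ltr_pMr// ltr1n.
have n1 := dotnorm_ge0 (e - e0); have n2 := dotnorm_ge0 (e' - e0).
have n3 := dotnorm_ge0 (w - w0).
have {}e1 : `|e - e0| < rho.
  by apply: near_rho (hE _).1 _; [rewrite lerDl ltW|lra].
have {}e2 : `|e' - e0| < rho.
  by apply: near_rho (hE _).1 _; [rewrite lerDl ltW|lra].
have {}e3 : `|w - w0| < rho.
  by apply: near_rho (hW _).1 _; [rewrite lerDr ltW|lra].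
pose grad (V : euclidType R) (x : V) := (smooth_norm d x)^-1 *: x.
(* The multiplier is the gradient of the coupling term in [e]; its gradient in [e'] is the opposite
   vector, so both normals share it. *)
exists e, e', (K *: grad _ (e - e')), (grad _ (e - e0)), (grad _ (e' - e0)), w,
  (grad _ (w - w0)).
split=> //.
- by split; [exact: lt_trans e1 _|exact: lt_trans e2 _|exact: lt_trans e3 _].
- split; try exact: dotnorm_gradient_smooth.
  rewrite /dotnorm dotZl dotZr mulrA -expr2 sqrtrM ?sqr_ge0// sqrtr_sqr.
  rewrite ger0_norm// -[leRHS]mulr1 ler_wpM2l//.
  exact: dotnorm_gradient_smooth.
- rewrite (_ : _ - _ = - (K *: grad _ (e - e') +
    (2 * eps) *: (grad _ (e - e0) + 0 + 0) + (- zeta + 0))); last first.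
    by rewrite !addr0 !opprD opprK [RHS]addrC addrA.
  apply: (@regular_normal_cone_local_min _ _ _ (fun x => pen d (x, (e', w)))).
  + exact: eE.
  + rewrite /pen /=; apply: upper_gradientD; first apply: upper_gradientD.
    * apply: upper_gradientZ => //.
      apply: upper_gradient_subr; exact: upper_gradient_smooth.
    * apply: upper_gradientZ; first by rewrite mulr_ge0// ltW.
      apply: upper_gradientD; last exact: upper_gradient_cst.
      apply: upper_gradientD; last exact: upper_gradient_cst.
      apply: upper_gradient_subr; exact: upper_gradient_smooth.
    * apply: upper_gradientD; last exact: upper_gradient_cst.
      exact: upper_gradient_affine.
  + near=> x; move=> Ax; apply: pmin; split=> //; split=> //=.
    by near: x; exact: nbhs_closed_ball_.
- rewrite [X in regular_normal_cone _ _ X](_ : _ =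
    - (K *: (- grad _ (e - e'), 0) +
    (2 * eps) *: (0 + (grad _ (e' - e0), 0) + (0, grad _ (w - w0))) +
    (0 + (0, - omega))) :> E * W); last first.
    congr (_, _) => /=.
      by rewrite !addr0 !add0r opprD scalerN opprK.
    by rewrite scaler0 !add0r opprD opprK addrC.
  apply: (@regular_normal_cone_local_min _ _ _ (fun x => pen d (e, x))).
  + exact: euclidean_prod.
  + rewrite /pen /=; apply: upper_gradientD; first apply: upper_gradientD.
    * apply: upper_gradientZ => //.
      apply: (upper_gradient_fst (phi := fun x => smooth_norm d (e - x))).
      apply: upper_gradient_subl; exact: upper_gradient_smooth.
    * apply: upper_gradientZ; first by rewrite mulr_ge0// ltW.
      apply: upper_gradientD.
        apply: upper_gradientD; first exact: upper_gradient_cst.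
        apply: (upper_gradient_fst (phi := fun x => smooth_norm d (x - e0))).
        apply: upper_gradient_subr; exact: upper_gradient_smooth.
      apply: (upper_gradient_snd (phi := fun x => smooth_norm d (x - w0))).
      apply: upper_gradient_subr; exact: upper_gradient_smooth.
    * apply: upper_gradientD; first exact: upper_gradient_cst.
      apply: (upper_gradient_snd (phi := fun x => dot (- omega) (x - w0))).
      exact: upper_gradient_affine.
  + near=> x; move=> Bx; apply: pmin; split=> //; split=> //=.
    near: x; apply: (@nbhs_closed_ball_ R (E * W)%type (e0, w0) (e', w) rho).
    by rewrite prod_normE /= gt_max e2.
Unshelve. all: by end_near. Qed.

End penalization.

(** As [eps] tends to 0 the bound [K] on the multipliers stays fixed, so they have a cluster point,
    and the perturbations of order [eps] vanish. *)
Lemma coupled_limiting_normals (R : realType) (E W : euclidType R)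
    (A : set E) (B : set (E * W)) (ebar zeta : E) (wbar omega : W) (K : R) :
  euclidean E -> euclidean W -> closed A -> closed B -> 0 <= K ->
  (forall eps, 0 < eps -> exists (e0 zeta0 : E) (w0 omega0 : W),
     [/\ A e0, B (e0, w0), `|e0 - ebar| < eps /\ `|w0 - wbar| < eps,
         `|zeta0 - zeta| < eps /\ `|omega0 - omega| < eps &
         exact_coupling A B e0 w0 zeta0 omega0 K eps]) ->
  exists alpha : E, limiting_normal_cone A ebar (zeta - alpha) /\
    limiting_normal_cone B (ebar, wbar) (alpha, omega).
Proof.
move=> eE eW cA cB K0 h.
have [[cE cE0 hE] kE] := eE; have [[cW cW0 hW] _] := eW.
pose c := cE + cW; have c0 : 0 < c by exact: addr_gt0.
have bE (x : E) : dotnorm x <= 1 -> `|x| <= c.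
  move=> x1; apply: le_trans (hE x).1 _.
  by rewrite /c; have := dotnorm_ge0 x; nra.
have bW (x : W) : dotnorm x <= 1 -> `|x| <= c.
  move=> x1; apply: le_trans (hW x).1 _.
  by rewrite /c; have := dotnorm_ge0 x; nra.
pose P eps (alpha : E) := exists (e e' g h1 : E) (w h2 : W),
  [/\ A e /\ B (e', w),
      [/\ `|e - ebar| < eps, `|e' - ebar| < eps & `|w - wbar| < eps],
      regular_normal_cone A e g /\ regular_normal_cone B (e', w) (h1, h2) &
      [/\ `|g - (zeta - alpha)| < eps, `|h1 - alpha| < eps &
          `|h2 - omega| < eps]].
have {}h eps : 0 < eps -> exists2 alpha, dotnorm alpha <= K & P eps alpha.
  (* Two displacements of size [eps'] and one perturbation of size at most [2 * eps' * c] add up to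
     [eps]. *)
  move=> eps0; pose eps' := eps / (2 + 2 * c).
  have c20 : 0 < 2 + 2 * c by lra.
  have eps'0 : 0 < eps' by exact: divr_gt0.
  have epsE : eps' * (2 + 2 * c) = eps by rewrite divfK// gt_eqF.
  have [e0 [zeta0 [w0 [omega0 [Ae0 Bw0 [e0b w0b] [z0b o0b] coupling]]]]] :=
    h _ eps'0.
  have [e [e' [alpha [u1 [u2 [w [u3]]]]]]] := penalized_multipliers eE eW cA cB
    Ae0 Bw0 K0 eps'0 coupling eps'0.
  move=> [[Ae Bw] [ee0 ee0' ww0] [u1b u2b u3b aK] NA NB].
  exists alpha => //; exists e, e', (zeta0 - alpha - (2 * eps') *: u1),
    (alpha - (2 * eps') *: u2), w, (omega0 - (2 * eps') *: u3).
  have tri (V : normedModType R) (x y z : V) :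
      `|x - y| < eps' -> `|y - z| < eps' -> `|x - z| < eps.
    move=> xy yz; rewrite -(subrKA y) (le_lt_trans (ler_normD _ _))//.
    by rewrite -epsE; have := mulr_gt0 eps'0 c0; lra.
  have eps'20 : 0 < 2 * eps' by exact: mulr_gt0.
  have scal (V : normedModType R) (x : V) : `|x| <= c ->
      `|(2 * eps') *: x| <= 2 * eps' * c.
    by move=> xc; rewrite normrZ (gtr0_norm eps'20) ler_pM2l.
  split=> //.
    by split; [exact: tri e0b|exact: tri e0b|exact: tri w0b].
  split.
  - rewrite (_ : _ - _ = (zeta0 - zeta) - (2 * eps') *: u1).
      rewrite (le_lt_trans (ler_normB _ _))//.
      by rewrite -epsE; have := scal _ _ (bE _ u1b); lra.
    by rewrite addrAC opprB addrA subrK.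
  - rewrite addrC addKr normrN.
    by apply: le_lt_trans (scal _ _ (bE _ u2b)) _; rewrite -epsE; lra.
  - rewrite addrAC (le_lt_trans (ler_normB _ _))//.
    by rewrite -epsE; have := scal _ _ (bW _ u3b); lra.
have {h} /choice[a ha] k :
    exists alpha, dotnorm alpha <= K /\ P k.+1%:R^-1 alpha.
  by have [|alpha] := h k.+1%:R^-1; [rewrite invr_gt0|exists alpha].
have [k|alpha _ aa] := compact_cluster_seq (u := a) (kE 0 (cE * K)).
  rewrite /closed_ball_ /= sub0r normrN (le_trans (hE _).1)// ler_pM2l//.
  by have [] := ha k.
have {}aa eps : 0 < eps -> exists a', P (eps / 2) a' /\ `|a' - alpha| < eps / 2.
  move=> eps0; have eps20 : 0 < eps / 2 by exact: divr_gt0.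
  have [N _ Neps] := near_infty_natSinv_lt (PosNum eps20).
  have [k Nk ak] := aa _ N eps20; exists (a k); split=> //.
  have [_ [e [e' [g [h1 [w [h2]]]]]]] := ha k.
  have lt x := @lt_trans _ R _ x _ ^~ (Neps k Nk).
  move=> [AB [ee ee' ww] NN [gg hh1 hh2]]; exists e, e', g, h1, w, h2.
  by split=> //; split; exact: lt.
exists alpha; split; apply: limiting_normal_coneI => eps eps0.
- have [a' [[e [e' [g [h1 [w [h2 body]]]]]] a'a]] := aa _ eps0.
  move: body => [[Ae _] [ee _ _] [Ng _] [gz _ _]]; exists e, g; split=> //.
    by rewrite (lt_le_trans ee)// ler_pdivrMr// ler_peMr ?(ltW eps0)// ler1n.
  rewrite (_ : g - _ = (g - (zeta - a')) - (a' - alpha)).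
    by rewrite (le_lt_trans (ler_normB _ _))//; lra.
  by rewrite !opprB -addrA [a' - zeta + _]addrC subrKA.
- have [a' [[e [e' [g [h1 [w [h2 body]]]]]] a'a]] := aa _ eps0.
  move: body => [[_ Bw] [_ ee ww] [_ Nh] [_ h1a h2o]]; exists (e', w), (h1, h2).
  split=> //; rewrite prod_normE /= gt_max; apply/andP; split; try lra.
  rewrite -(subrKA a') (le_lt_trans (ler_normD _ _))//; lra.
Qed.

(** * Distances, and exact coupling from metric subregularity *)

Section distance.
Variables (R : realType) (V : euclidType R).
Implicit Types (z a : V) (A : set V).

Lemma dist_le z a A : A a -> (dist z A <= (enorm (a - z))%:E)%E.
Proof. by move=> Aa; apply: ereal_inf_lbound; exists a. Qed.

Lemma dist_lt z A t : (dist z A < t%:E)%E ->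
  exists2 a, A a & enorm (a - z) < t.
Proof. by move=> /ereal_inf_lt[_ [a Aa <-]]; rewrite lte_fin; exists a. Qed.

End distance.

Section feasibility.
Variables (R : realType) (n m s : nat).
Variables (F : 'rV[R]_n -> set 'rV[R]_m)
  (G : 'rV[R]_n * 'rV[R]_m -> set 'rV[R]_s).

(** Bounding each component separately gives 2 instead of the sharp square root of 2; this is the 2
    in the penalty constant [2 * L * kappa]. *)
Lemma enorm_le_dotnorm (e : 'rV[R]_n * 'rV[R]_m) : enorm e <= 2 * dotnorm e.
Proof.
have h1 : enorm e.1 <= dotnorm e.
  by rewrite -row_dotnormE ler_wsqrtr// /dot/= /prod_dot lerDl dot_ge0.
have h2 : enorm e.2 <= dotnorm e.
  by rewrite -row_dotnormE ler_wsqrtr// /dot/= /prod_dot lerDr dot_ge0.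
rewrite [leLHS](_ : _ = enorm e.1 + enorm e.2)//; lra.
Qed.

Lemma feasibility_inv_mapE z w q lam :
  inv_map (feasibility_map F G) (0, 0, 0) (z, w, q, lam) ->
  gph (Hmap F G) (z, w).
Proof.
move=> [a Fa [b Gb]] [/eqP zq /eqP al /eqP bw].
move: zq al bw; rewrite !subr_eq0 => /eqP zq /eqP al /eqP bw.
by exists lam; rewrite /= -?al// zq -bw al.
Qed.

(** Subregularity moves [(z, w, q, lam)] to a zero of the feasibility map at a cost controlled by
    [e - e']. Its first two components lie in the graph of [Hmap F G], where the regular normal
    inequality holds; the displacement costs at most [L] times its length. *)
Lemma exact_coupling_feasibility (z0 xi : 'rV[R]_n) (w0 omega : 'rV[R]_s)
    (lam0 : 'rV[R]_m) (kappa L eps : R) :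
  0 < kappa -> 0 < eps -> enorm xi <= L -> enorm omega <= L ->
  regular_normal_cone (gph (Hmap F G)) (z0, w0) (xi, omega) ->
  (\forall x \near ((z0, w0, z0, lam0) :
      'rV[R]_n * 'rV[R]_s * 'rV[R]_n * 'rV[R]_m),
    (dist x (inv_map (feasibility_map F G) (0, 0, 0)%R) <=
       kappa%:E * dist (0, 0, 0)%R (feasibility_map F G x))%E) ->
  F z0 lam0 -> G (z0, lam0) w0 ->
  exact_coupling (gph F) (gph G) (z0, lam0) w0 (xi, 0) omega
    (2 * L * kappa) eps.
Proof.
move=> kappa0 eps0 xiL omegaL N sub Flam0 Gw0.
have L0 : 0 <= L by apply: le_trans xiL; exact: enorm_ge0.
have [c c0 cH] := @enorm_equiv R ('rV[R]_n * 'rV[R]_s)%type.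
have [[cE cE0 hE] _] :=
  euclidean_prod (@euclidean_row R n) (@euclidean_row R m).
have [[cW cW0 hW] _] := @euclidean_row R s.
(* [eps1] is the slack in an approximate projection and [eps2] the tolerance in the normal
   inequality; each consumes half of [eps]. *)
pose eps1 := Num.min 1 (eps / (2 * (L + 1))).
pose eps2 := eps / (10 * c).
have eps10 : 0 < eps1.
  by rewrite lt_min ltr01 divr_gt0// mulr_gt0// ltr_wpDl.
have eps11 : eps1 <= 1 by rewrite ge_min lexx.
have Leps1 : L * eps1 <= eps / 2.
  have : eps1 * (2 * (L + 1)) <= eps.
    by rewrite -ler_pdivlMr ?ge_min ?lexx ?orbT// mulr_gt0// ltr_wpDl.
  by have := ltW eps10; lra.
have eps20 : 0 < eps2 by rewrite divr_gt0// mulr_gt0.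
have eps2E : eps2 * (10 * c) = eps by rewrite divfK// gt_eqF// mulr_gt0.
have eucH := euclidean_prod (@euclidean_row R n) (@euclidean_row R s).
have [r2 r20 Nr2] := regular_normal_cone_le eucH N eps20.
have [r1 /= r10 sub1] := iffLR (nbhs_ballP _ _) sub.
(* Radius [r2 / C] makes [c * (5 * T) < r2], so the projected point stays where the normal
   inequality is valid. *)
pose C := c * (5 * (2 * cE + cW)).
have C0 : 0 < C by rewrite mulr_gt0// mulr_gt0// addr_gt0// mulr_gt0.
exists (Num.min r1 (r2 / C)); first by rewrite lt_min r10 divr_gt0.
move=> [z bet] [q lam] w /= Fz Gq; rewrite !lt_min.
move=> /andP[er1 er2] /andP[e'r1 e'r2] /andP[wr1 wr2].
set e0 : 'rV[R]_n * 'rV[R]_m := (z0, lam0).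
set e : 'rV[R]_n * 'rV[R]_m := (z, bet).
set e' : 'rV[R]_n * 'rV[R]_m := (q, lam).
set T := dotnorm (e - e0) + dotnorm (e' - e0) + dotnorm (w - w0).
have de := dotnorm_ge0 (e - e0); have de' := dotnorm_ge0 (e' - e0).
have dw := dotnorm_ge0 (w - w0).
have Tr : c * (5 * T) < r2.
  have h x d : x < r2 / C -> d <= cE * x -> d <= cE * (r2 / C).
    by move=> xr; move/le_trans; apply; rewrite ler_pM2l// ltW.
  have h1 := h _ _ er2 (hE _).2.
  have h2 := h _ _ e'r2 (hE _).2.
  have h3 : dotnorm (w - w0) < cW * (r2 / C).
    by apply: le_lt_trans (hW _).2 _; rewrite ltr_pM2l.
  have : C * (r2 / C) = r2 by rewrite mulrC divfK// gt_eqF.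
  rewrite {1}/C -mulrA => <-; rewrite ltr_pM2l// -mulrA ltr_pM2l//.
  by rewrite /T mulrDl; lra.
(* The slack [eps1 * T] must be positive for the infimum in [dist] to be nearly attained; for
   [T = 0] the linear form vanishes. *)
have [T0|T0] : T = 0 \/ 0 < T.
- by have [|T0] := ltP 0 T; [right|left; apply/eqP; rewrite eq_le T0 !addr_ge0].
- have {de}de0 : dotnorm (e - e0) = 0 by rewrite /T in T0; lra.
  have {dw}dw0 : dotnorm (w - w0) = 0 by rewrite /T in T0; lra.
  rewrite T0 mulr0 addr0.
  have := ler_dot_dotnorm ((xi, 0) : 'rV[R]_n * 'rV[R]_m) (e - e0).
  have := ler_dot_dotnorm omega (w - w0).
  rewrite de0 dw0 !mulr0 => h1 h2.
  rewrite (le_trans (lerD h2 h1))// addr0 !mulr_ge0 ?dotnorm_ge0//.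
  exact: ltW.
pose xhat : 'rV[R]_n * 'rV[R]_s * 'rV[R]_n * 'rV[R]_m := (z0, w0, z0, lam0).
pose x : 'rV[R]_n * 'rV[R]_s * 'rV[R]_n * 'rV[R]_m := (z, w, q, lam).
pose D := inv_map (feasibility_map F G) (0, 0, 0).
have Dxhat : D xhat.
  by exists lam0 => //; exists w0 => //; rewrite !subrr.
(* Comparison with the zero [xhat] keeps the projected point near the base point; subregularity
   alone does not bound the displacement by [T]. *)
have dX : (dist x D <= (2 * T)%:E)%E.
  apply: le_trans (dist_le x Dxhat) _; rewrite lee_fin.
  rewrite -enormN opprB.
  rewrite [leLHS](_ : _ = enorm (z - z0) + enorm (w - w0) + enorm (q - z0) +
    enorm (lam - lam0))//.
  have := enorm_le_dotnorm (e - e0); have := enorm_le_dotnorm (e' - e0).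
  rewrite [enorm (e' - e0)](_ : _ = enorm (q - z0) + enorm (lam - lam0))//.
  rewrite [enorm (e - e0)](_ : _ = enorm (z - z0) + enorm (bet - lam0))//.
  rewrite -(row_dotnormE (w - w0)); have := enorm_ge0 (bet - lam0).
  rewrite /T; lra.
have dY : (dist x D <= (kappa * (2 * dotnorm (e - e')))%:E)%E.
  apply: (@le_trans _ _
    (kappa%:E * dist (0, 0, 0)%R (feasibility_map F G x))%E).
    apply: sub1; rewrite -ball_normE /= !prod_normE /= !gt_max.
    move: er1 e'r1; rewrite !prod_normE /= !gt_max.
    rewrite !(distrC z0) (distrC w0) (distrC lam0).
    by move=> /andP[-> _] /andP[-> ->]; rewrite wr1.
  rewrite EFinM lee_pmul2l// ?lte_fin//.
  (* The values [bet] and [w] themselves make the residual [e - e'], with zero last component. *)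
  have Gx : feasibility_map F G x (z - q, bet - lam, 0).
    by exists bet => //; exists w => //; rewrite subrr.
  apply: le_trans (dist_le _ Gx) _; rewrite lee_fin.
  rewrite !subr0.
  rewrite [leLHS](_ : _ = enorm (e - e') + enorm (0 : 'rV[R]_s))//.
  by rewrite enorm0 addr0 enorm_le_dotnorm.
have : (dist x D < (Num.min (2 * T) (kappa * (2 * dotnorm (e - e'))) +
    eps1 * T)%:E)%E.
  apply: (@le_lt_trans _ _
    (Num.min (2 * T) (kappa * (2 * dotnorm (e - e'))))%:E).
    by rewrite EFin_min le_min dX.
  by rewrite lte_fin ltrDl mulr_gt0.
move=> /dist_lt[[[[z' w'] q'] lam'] Dx'].
rewrite [enorm _](_ : _ = enorm (z' - z) + enorm (w' - w) + enorm (q' - q) +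
  enorm (lam' - lam))// => x'x.
have eq := enorm_ge0 (q' - q); have el := enorm_ge0 (lam' - lam).
have ez := enorm_ge0 (z' - z); have ew := enorm_ge0 (w' - w).
have {x'x} [x'x1 x'x2] : enorm (z' - z) + enorm (w' - w) < 2 * T + eps1 * T /\
    enorm (z' - z) + enorm (w' - w) <
      kappa * (2 * dotnorm (e - e')) + eps1 * T.
  move: x'x; rewrite addr_minl lt_min => /andP[]; split; lra.
have eT : eps1 * T <= T by rewrite ler_piMl// ltW.
have HT : enorm (z - z0) + enorm (w - w0) <= 2 * T.
  have := enorm_le_dotnorm (e - e0).
  rewrite [enorm (e - e0)](_ : _ = enorm (z - z0) + enorm (bet - lam0))//.
  rewrite -(row_dotnormE (w - w0)); have := enorm_ge0 (bet - lam0).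
  rewrite /T; lra.
(* The factor 5 is 2 + 1 + 2: projection distance, slack with [eps1 <= 1], and distance of [(z, w)]
   from [(z0, w0)]. *)
have H' : `|((z', w') : 'rV[R]_n * 'rV[R]_s) - (z0, w0)| <= c * (5 * T).
  apply: le_trans (cH _).1 _; rewrite ler_pM2l//.
  rewrite [leLHS](_ : _ = enorm (z' - z0) + enorm (w' - w0))//.
  have := ler_enormD (z' - z) (z - z0); have := ler_enormD (w' - w) (w - w0).
  rewrite !subrKA; lra.
have := Nr2 _ (feasibility_inv_mapE Dx') (le_lt_trans H' Tr).
rewrite [dot _ _](_ : _ = dot xi (z' - z0) + dot omega (w' - w0))// => NH.
rewrite [dot _ (e - e0)](_ : _ =
  dot xi (z - z0) + dot (0 : 'rV[R]_m) (bet - lam0))//.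
rewrite dot0l addr0.
have hz : dot xi (z - z') <= L * enorm (z' - z).
  apply: le_trans (ler_dot_dotnorm _ _) _.
  by rewrite !row_dotnormE -[enorm (z - z')]enormN opprB ler_wpM2r.
have hw : dot omega (w - w') <= L * enorm (w' - w).
  apply: le_trans (ler_dot_dotnorm _ _) _.
  by rewrite !row_dotnormE -[enorm (w - w')]enormN opprB ler_wpM2r.
have : dot xi (z - z0) = dot xi (z - z') + dot xi (z' - z0).
  by rewrite -dotDr subrKA.
have : dot omega (w - w0) = dot omega (w - w') + dot omega (w' - w0).
  by rewrite -dotDr subrKA.
have h1 := ler_wpM2l L0 (ltW x'x2).
have h2 := ler_wpM2l (ltW eps20) H'.
have h3 : eps2 * (c * (5 * T)) = eps / 2 * T by rewrite -eps2E; field.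
have h4 := ler_wpM2r (ltW T0) Leps1.
move=> -> ->; lra.
Qed.

End feasibility.

(** * From implicit to explicit stationarity *)

Lemma cvg_increasing_seq (phi : nat -> nat) :
  increasing_seq phi -> phi l @[l --> \oo] --> \oo.
Proof.
move=> phi_inc.
have phi_ge l : (l <= phi l)%N.
  elim: l => // l /leq_ltn_trans; apply.
  by have /increasing_seqP := phi_inc; exact.
move=> P [N _ NP]; exists N => // l /= Nl.
by apply: NP; exact: leq_trans Nl (phi_ge l).
Qed.

Theorem proposition4p16 (R : realType) (n m s : nat)
    (f : 'rV[R]_n -> R) (F : 'rV[R]_n -> set 'rV[R]_m)
    (G : 'rV[R]_n * 'rV[R]_m -> set 'rV[R]_s) (M : set 'rV[R]_n)
    (f_lip : locally_lipschitz f)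
    (F_closed : closed (gph F)) (G_closed : closed (gph G))
    (M_nonempty : M !=set0) (M_closed : closed M)
    (H_closed : locally_closed (gph (Hmap F G)))
    (zbar : 'rV[R]_n)
    (zbar_stat : implicitly_M_stationary f F G M zbar)
    (semicompact : inner_semicompact (intermediate_map F G) (zbar, 0)
                     (dom (intermediate_map F G)))
    (subregular : forall lam : 'rV[R]_m, Kmap F G zbar lam ->
       metrically_subregular (feasibility_map F G)
         ((zbar, 0, zbar, lam), (0, 0, 0))) :
  explicitly_M_stationary f F G M zbar.
Proof.
case: zbar_stat => feas [nu [v [xif xifP [xi xiP vE]] [xiM xiMP sum0]]].
split=> //.
case: xiP => zk [xik [Hzk zk_cvg Nxik xik_cvg]].
(* The domain of the intermediate map contains the graph of [Hmap F G], so semicompactness applies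
   to the base points of the approximating normals. *)
have zk_dom k : dom (intermediate_map F G) (zk k).
  by have [lam Flam Glam] := Hzk k; exists ((zk k).1, lam).
have [phi [y [phi_inc y_cvg yP]]] := semicompact.2 zk zk_dom zk_cvg.
have phi_oo := cvg_increasing_seq phi_inc.
pose z l := (zk (phi l)).1; pose w l := (zk (phi l)).2; pose lam l := (y l).2.
pose lambar := (lim (y l @[l --> \oo])).2.
have Flam l : F (z l) (lam l) by have [_ []] := yP l.
have Gw l : G (z l, lam l) (w l) by have [_ []] := yP l.
have zk_phi : zk (phi l) @[l --> \oo] --> (zbar, 0).
  exact: (cvg_comp _ _ phi_oo zk_cvg).
have xik_phi : xik (phi l) @[l --> \oo] --> (xi, - nu).
  exact: (cvg_comp _ _ phi_oo xik_cvg).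
have z_cvg : z l @[l --> \oo] --> zbar by exact: (cvg_comp _ _ zk_phi cvg_fst).
have w_cvg : w l @[l --> \oo] --> 0 by exact: (cvg_comp _ _ zk_phi cvg_snd).
have lam_cvg : lam l @[l --> \oo] --> lambar.
  exact: (cvg_comp _ _ y_cvg cvg_snd).
have zlam_cvg : (z l, lam l) @[l --> \oo] --> (zbar, lambar).
  exact: cvg_pair z_cvg lam_cvg.
have Flambar : F zbar lambar.
  apply: (@closed_cvg _ _ _ _ (fun l => (z l, lam l)) (gph F) F_closed _ _
    zlam_cvg).
  exact: nearW.
have Glambar : gph G ((zbar, lambar), 0).
  have zlamw_cvg : (z l, lam l, w l) @[l --> \oo] --> (zbar, lambar, 0).
    exact: cvg_pair zlam_cvg w_cvg.
  apply: (@closed_cvg _ _ _ _ (fun l => (z l, lam l, w l)) (gph G) G_closed _ _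
    zlamw_cvg).
  exact: nearW.
have [_ [kappa kappa0 sub]] := subregular lambar (conj Flambar Glambar).
have x_cvg : (z l, w l, z l, lam l) @[l --> \oo] --> (zbar, 0, zbar, lambar).
  exact: cvg_pair (cvg_pair (cvg_pair z_cvg w_cvg) z_cvg) lam_cvg.
(* Passing to the interior makes the estimate at the limit valid, with the same [kappa], around each
   late point of the sequence. *)
have {x_cvg}sub := x_cvg _ (nbhs_interior sub).
have [c c0 cN] := @enorm_equiv R ('rV[R]_n * 'rV[R]_s)%type.
(* Bounds all normals within distance 1 of the limit, so the penalty constant does not depend on
   [l]. *)
pose L := c * (`|(xi, - nu) : 'rV[R]_n * 'rV[R]_s| + 1).
have [||alpha [NF NG]] := @coupled_limiting_normals R
  ('rV[R]_n * 'rV[R]_m)%type 'rV[R]_s (gph F) (gph G) (zbar, lambar) (xi, 0)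
  0 (- nu) (2 * L * kappa)
  (euclidean_prod (@euclidean_row R n) (@euclidean_row R m))
  (@euclidean_row R s) F_closed G_closed.
- by rewrite !mulr_ge0// ltW.
- move=> eps eps0.
  near \oo => l.
  have xik1 : `|xik (phi l) - (xi, - nu)| < 1.
    by near: l; apply: cvgr_distC_lt xik_phi _ _.
  have xik2 : `|xik (phi l) - (xi, - nu)| < eps.
    by near: l; apply: cvgr_distC_lt xik_phi _ _.
  have zlam_eps : `|(z l, lam l) - (zbar, lambar)| < eps.
    by near: l; apply: cvgr_distC_lt zlam_cvg _ _.
  have w_eps : `|w l - 0| < eps by near: l; apply: cvgr_distC_lt w_cvg _ _.
  have subl : (fun x => (dist x (inv_map (feasibility_map F G) (0, 0, 0)%R) <=
      kappa%:E * dist (0, 0, 0)%R (feasibility_map F G x))%E)°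
      (z l, w l, z l, lam l).
    by near: l; exact: sub.
  case xikE : (xik (phi l)) => [xil oml].
  exists (z l, lam l), (xil, 0), (w l), oml; split=> //.
  + exact: Flam.
  + exact: Gw.
  + move: xik2; rewrite xikE !prod_normE /= !gt_max => /andP[-> ->].
    by rewrite subrr normr0 eps0.
  + have xilL : enorm xil + enorm oml <= L.
      apply: le_trans (cN (xil, oml)).2 _; rewrite ler_pM2l// -xikE.
      rewrite -[xik _](subrK (xi, - nu)) (le_trans (ler_normD _ _))//.
      by rewrite addrC lerD2l ltW.
    have xil0 := enorm_ge0 xil; have oml0 := enorm_ge0 oml.
    apply: exact_coupling_feasibility (Flam l) (Gw l) => //; [lra|lra|].
    rewrite -xikE (_ : (z l, w l) = zk (phi l)); first exact: Nxik.
    by rewrite /z /w; case: (zk _).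
(* The second component of [alpha] is the multiplier mu, and [xi] splits as
   [(xi - alpha.1) + alpha.1] between the coderivatives of [F] and [G]. *)
exists lambar, (alpha.2), nu; split=> //.
exists (xif + xi) => //; last by exists xiM => //; rewrite vE.
exists (xif + (xi - alpha.1)).
  exists xif => //; exists (xi - alpha.1) => //.
  rewrite /coderivative /=; move: NF.
  by rewrite [(xi, 0) - alpha](_ : _ = (xi - alpha.1, - alpha.2))//;
    congr (_, _); rewrite /= sub0r.
exists alpha.1; first by rewrite /coderivative /= -surjective_pairing.
by rewrite -addrA subrK.
Unshelve. all: by end_near. Qed.
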